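(* Let $P$ and $Q$ be probability measures on a measurable space $\mathcal{X}$, let $Q = Q_a + Q_s$ be the Lebesgue decomposition of $Q$ with respect to $P$ ($Q_a \ll P$, $Q_s \perp P$), and let $U : [0,\infty] \to [-\infty,\infty]$ be measurable. Assume that $U$ is concave and non-decreasing, and finite on $(0,\infty)$. Suppose $\varepsilon^*$ is a $U$-optimal e-value for $H=\{P\}$. Then there exists a $\lambda \in [0,\infty)$ such that $$\varepsilon^*(x) \in \operatorname*{arg\,max}_{z \in [0,\infty)} \left\{\frac{dQ_a}{dP}(x)\, U(z) - \lambda z\right\}, \quad P\text{-a.s.},$$ and $\lambda\,(1 - \mathrm{E}^P[\varepsilon^*]) = 0$.
   Context: Notation: $\mathrm{E}^\mu[f]=\int f\,d\mu$ for any nonnegative measure $\mu$; $dQ_a/dP$ is a $[0,\infty)$-valued version of the Radon--Nikodym derivative; convention $0\times U(z)=0$. Concavity and monotonicity of $U$ are understood on $[0,\infty)$ (valid e-values are finite $P$-a.s., hence $Q_a$-a.s., so $U(\infty)$ is immaterial). An e-value is a measurable map $\varepsilon:\mathcal{X}\to[0,\infty]$; it is valid for the simple hypothesis $H=\{P\}$ if $\mathrm{E}^P[\varepsilon]\le 1$. A valid e-value $\varepsilon^*$ is $U$-optimal (against $Q_a$) if, for every valid e-value $\varepsilon$, $\mathrm{E}^{Q_a}[U(\varepsilon^* )-U(\varepsilon)]$ is well-defined and $\geq 0$. Here ''well-defined'' means that the integrand avoids an ambiguous $\infty-\infty$ $Q_a$-almost surely, and that its positive part or its negative part has finite $Q_a$-expectation.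 *)

(* Defs.v *)
From HB Require Import structures.
From mathcomp Require Import all_boot all_order all_algebra.
From mathcomp Require Import all_classical all_reals all_analysis.
From mathcomp Require Import measurable_realfun.

Set Implicit Arguments.
Unset Strict Implicit.
Unset Printing Implicit Defensive.

Import Order.TTheory GRing.Theory Num.Theory.

Local Open Scope classical_set_scope.
Local Open Scope ring_scope.
Local Open Scope ereal_scope.

Section Measures.
Context (d : measure_display) (X : measurableType d) (R : realType).
Implicit Types mu nu : {measure set X -> \bar R}.

Definition mutually_singular mu nu : Prop :=
  exists N : set X, [/\ measurable N, mu N = 0 & nu (~` N) = 0].

Definition lebesgue_decomposition (Q P Qa Qs : {measure set X -> \bar R}) : Prop :=
  [/\ forall A : set X, measurable A -> Q A = Qa A + Qs A,
      Qa `<< P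
    & mutually_singular Qs P].

(* The library derivative 'd nu '/d mu is extended-real valued; this predicate
   describes the versions with values in [0, +oo[. *)
Definition is_RN_version nu mu (q : X -> R) : Prop :=
  [/\ measurable_fun setT q,
      forall x : X, (0 <= q x)%R
    & forall A : set X, measurable A -> nu A = \int[mu]_(x in A) (q x)%:E].

Definition e_value (e : X -> \bar R) : Prop :=
  measurable_fun setT e /\ forall x : X, 0 <= e x.

Definition valid_e_value (P : {measure set X -> \bar R}) (e : X -> \bar R) : Prop :=
  e_value e /\ \int[P]_x e x <= 1.

(* The library integral is total and so is extended-real subtraction, hence the
   explicit well-definedness; [a +? - b] says that [a - b] is not of the form
   oo - oo. *)
Definition well_defined_expectation_diff mu (f g : X -> \bar R) : Prop :=
  {ae mu, forall x, f x +? - g x} /\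
  (\int[mu]_x ((fun y => f y - g y)^\+ x) < +oo \/
   \int[mu]_x ((fun y => f y - g y)^\- x) < +oo).

Definition U_optimal (U : \bar R -> \bar R) (P Qa : {measure set X -> \bar R})
    (estar : X -> \bar R) : Prop :=
  valid_e_value P estar /\
  forall e : X -> \bar R, valid_e_value P e ->
    well_defined_expectation_diff Qa (U \o estar) (U \o e) /\
    0 <= \int[Qa]_x (U (estar x) - U (e x)).

End Measures.

Section Utility.
Context (R : realType).
Implicit Type U : \bar R -> \bar R.

(* A utility is only ever meaningful on [0, +oo]; its values at negative
   arguments are junk, and its value at +oo is unconstrained. *)
Definition utility_nondecreasing U : Prop :=
  forall a b : R, (0 <= a)%R -> (a <= b)%R -> U a%:E <= U b%:E.

(* U 0 may be -oo; the library convention 0 * -oo = 0 handles t = 0, 1. *)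
Definition utility_concave U : Prop :=
  forall a b t : R, (0 <= a)%R -> (0 <= b)%R -> (0 <= t <= 1)%R ->
    t%:E * U a%:E + (1 - t)%:E * U b%:E <= U (t * a + (1 - t) * b)%:E.

Definition utility_finite U : Prop :=
  forall z : R, (0 < z)%R -> U z%:E \is a fin_num.

End Utility.

Definition argmax (T : Type) (R : realType) (D : set T) (f : T -> \bar R) : set T :=
  [set z | D z /\ forall w, D w -> f w <= f z].

(* Main.v *)
Require Import Defs.
From HB Require Import structures.
From mathcomp Require Import all_boot all_order all_algebra.
From mathcomp Require Import all_classical all_reals all_analysis.
From mathcomp Require Import measurable_realfun.
From mathcomp Require Import ring lra.

Set Implicit Arguments.
Unset Strict Implicit.
Unset Printing Implicit Defensive.

Import Order.TTheory GRing.Theory Num.Theory.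

Local Open Scope classical_set_scope.
Local Open Scope ring_scope.
Local Open Scope ereal_scope.

(** Why a multiplier exists. Write z for estar and call
      q * (U w - U z) - c * (w - z)
    the excess of the target w at price c: it compares w with z in the
    Lagrangian that charges c per unit of payoff. The pair (lambda, estar)
    solves the pointwise problem exactly when no target has positive excess at
    price lambda. By concavity the excess on the targets above z and on those
    below z are governed by the one-sided derivatives of q * U at z, so lambda
    has to separate the right derivatives, over all x, from the left ones. Were
    this impossible, some price c would leave room for raising estar on one
    non-null set and lowering it on another, both with positive excess.

    Such an improvement is built by moving estar a fraction of the way towards
    targets w > z on the first set and w' < z on the second, the fractions being
    balanced so that the mean under P is unchanged ([two_sided_exchange]). By
    concavity the utility moves at least by that fraction of U w - U z, which
    turns optimality of estar into a statement about the excess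
    ([mixing_no_gain]). The multiplier is then the infimum of the prices
    at which raising never pays ([multiplier_exists]). If the constraint is
    slack, raising needs no compensation, hence never pays even at price 0 and
    the infimum is 0 ([slack_multiplier]): this is complementary slackness.

    Convex combinations replace derivatives, and the targets are constants. In
    the end only positive rational ones are needed: U is finite there, countably
    many null sets are harmless, and monotonicity of U recovers all targets
    ([excess_argmax]).

    The utility of estar need not be integrable. What optimality does provide
    is the sign of the integral of a difference of utilities, and that
    difference is bounded above by a linear function of the perturbation, which
    is integrable because e-values have finite mean ([ae_eq_density_majorant]).
*)

(** * Integration against a measure with a density *)

Section Density.
Context (d : measure_display) (X : measurableType d) (R : realType).

(** Nonnegative functions suffice here: signed integrals are handled through
    their positive and negative parts, neither of which is known to be finite.
    The derivative attached to a finite measure is almost everywhere equal to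
    any other version q of it, because their integrals agree on all sets. *)
Lemma integral_density (mu : {sigma_finite_measure set X -> \bar R})
    (nu : {measure set X -> \bar R}) (q : X -> R) (f : X -> \bar R) :
  nu setT < +oo -> nu `<< mu -> is_RN_version nu mu q ->
  measurable_fun setT f -> (forall x, 0 <= f x) ->
  \int[nu]_x f x = \int[mu]_x (f x * (q x)%:E).
Proof.
move=> nufin numu [mq q0 nuE] mf f0.
(* Restriction to the full space turns nu into a finite-measure structure. *)
pose nu' : {finite_measure set X -> \bar R} := mfrestr measurableT nufin.
have nu'E : nu' = nu :> (set X -> \bar R).
  by apply/funext => A; rewrite /nu' /= /mfrestr /mrestr setIT.
have numu' : nu' `<< mu by rewrite nu'E.
pose g := Radon_Nikodym_SigmaFinite.f nu' mu.
have intg : mu.-integrable setT g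
  by exact: Radon_Nikodym_SigmaFinite.f_integrable.
have meq : measurable_fun setT (EFin \o q) by exact/measurable_EFinP.
have gq : ae_eq mu setT g (EFin \o q).
  apply: integral_ae_eq => // E _ mE.
  rewrite -(Radon_Nikodym_SigmaFinite.f_integral numu')// -nuE//.
  exact: (congr1 (@^~ E) nu'E).
rewrite (eq_measure_integral nu') => [|A _ _]; last first.
  exact: (congr1 (@^~ A) (esym nu'E)).
rewrite -(Radon_Nikodym_SigmaFinite.change_of_variables numu')//.
apply: ae_eq_integral => //.
- by apply: emeasurable_funM => //; exact: measurable_int intg.
- exact: emeasurable_funM.
- exact: ae_eqe_mul2l.
Qed.

(** A set that is null for nu may be charged by mu only where the density
    vanishes. *)
Lemma ae_density (mu : {measure set X -> \bar R})
    (nu : {measure set X -> \bar R}) (q : X -> R) (S : X -> Prop) :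
  is_RN_version nu mu q -> {ae nu, forall x, S x} ->
  {ae mu, forall x, (0 < q x)%R -> S x}.
Proof.
move=> [mq q0 nuE] [N [mN N0 SN]].
have meq : measurable_fun setT (EFin \o q) by exact/measurable_EFinP.
have /(ae_eq_integral_abs _ mN) : \int[mu]_(x in N) `|(EFin \o q) x| = 0.
  rewrite -[RHS]N0 nuE//; apply: eq_integral => x _ /=.
  by rewrite ger0_norm.
move/(_ (measurable_funTS meq)); apply: filterS => x /= qN qx.
apply: contrapT => nS; have [q00] := qN (SN _ nS).
by move: qx; rewrite q00 ltxx.
Qed.

Lemma ae_dominated (mu nu : {measure set X -> \bar R}) (S : X -> Prop) :
  nu `<< mu -> {ae mu, forall x, S x} -> {ae nu, forall x, S x}.
Proof.
move=> /null_content_dominatesP numu [N [mN N0 SN]].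
by exists N; split => //; exact: numu.
Qed.

Lemma ae_forall_countable (I : countType) (mu : {measure set X -> \bar R})
    (S : I -> X -> Prop) :
  (forall i, {ae mu, forall x, S i x}) -> {ae mu, forall x, forall i, S i x}.
Proof.
move=> h; pose S' n x := if unpickle n is Some i then S i x else True.
have : {ae mu, forall x n, S' n x}.
  apply: ae_foralln => n; rewrite /S'.
  by case: unpickle => [i|]; [exact: h|exact: aeW].
by apply: filterS => x Sx i; have := Sx (pickle i); rewrite /S' pickleK.
Qed.

(** The integral is total: f and g may fail to be integrable, and the inequality
    then still follows from those of the positive and negative parts, whose
    difference is monotone even with infinite values. *)
Lemma le_ae_integral (mu : {measure set X -> \bar R}) (f g : X -> \bar R) :
  measurable_fun setT f -> measurable_fun setT g ->
  {ae mu, forall x, f x <= g x} -> \int[mu]_x f x <= \int[mu]_x g x.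
Proof.
move=> mf mg fg; rewrite integralE [leRHS]integralE; apply: leeB.
  apply: ae_ge0_le_integral => //; [exact: measurable_funepos..|].
  apply: filterS fg => x fgx _.
  by rewrite !funeposE ge_max !le_max fgx lexx orbT.
apply: ae_ge0_le_integral => //; [exact: measurable_funeneg..|].
apply: filterS fg => x fgx _.
by rewrite !funenegE ge_max !le_max leeN2 fgx lexx orbT.
Qed.

Lemma integral_linear_combination (mu : {measure set X -> \bar R})
    (f g : X -> R) (a b : R) :
  mu.-integrable setT (EFin \o f) -> mu.-integrable setT (EFin \o g) ->
  \int[mu]_x (a * f x + b * g x)%:E =
    a%:E * \int[mu]_x (f x)%:E + b%:E * \int[mu]_x (g x)%:E.
Proof.
move=> intf intg.
under eq_integral => x _ do rewrite EFinD !EFinM.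
by rewrite integralD ?integralZl//; exact: integrableZl.
Qed.

Lemma ae_eq0_integral (mu : {measure set X -> \bar R}) (f : X -> R) :
  measurable_fun setT f -> (forall x, (0 <= f x)%R) ->
  \int[mu]_x (f x)%:E = 0 -> {ae mu, forall x, (f x = 0)%R}.
Proof.
move=> mf f0 int0; have mef : measurable_fun setT (EFin \o f)
  by exact/measurable_EFinP.
have /(ae_eq_integral_abs _ measurableT mef) :
    \int[mu]_x `|(EFin \o f) x| = 0.
  by rewrite -[RHS]int0; apply: eq_integral => x _ /=; rewrite ger0_norm.
by apply: filterS => x /(_ I) [].
Qed.

(** The form in which optimality is exploited: f will be a loss of utility, whose
    integral is nonnegative, l a finite bound for it obtained by concavity, and
    m the value at price c of the payoff given up. The chain
      0 <= int f dnu <= int l dnu = int q l dmu <= int m dmu <= 0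
    collapses. The bound by an integrable m controls the positive part of
    q l, and the nonnegative integral then controls its negative part. *)
Lemma ae_eq_density_majorant (mu : {sigma_finite_measure set X -> \bar R})
    (nu : {measure set X -> \bar R}) (q : X -> R)
    (f : X -> \bar R) (l m : X -> R) :
  nu setT < +oo -> nu `<< mu -> is_RN_version nu mu q ->
  measurable_fun setT f -> measurable_fun setT l ->
  0 <= \int[nu]_x f x -> {ae nu, forall x, f x <= (l x)%:E} ->
  mu.-integrable setT (EFin \o m) -> (forall x, (q x * l x <= m x)%R) ->
  \int[mu]_x (m x)%:E <= 0 -> {ae mu, forall x, (q x * l x = m x)%R}.
Proof.
move=> nufin numu hq mf ml f0 fl intm qlm m_le0.
have [mq q0 _] := hq.
have mm : measurable_fun setT m
  by apply/measurable_EFinP; exact: measurable_int intm.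
have mel : measurable_fun setT (EFin \o l) by exact/measurable_EFinP.
have posE : \int[nu]_x (EFin \o l)^\+ x =
    \int[mu]_x (fun x => (q x * l x)%:E)^\+ x.
  rewrite (integral_density nufin numu hq)//; last exact: measurable_funepos.
  apply: eq_integral => x _; rewrite !funeposE /= -!EFin_max -EFinM; congr EFin.
  by rewrite mulrC maxr_pMr// mulr0.
have negE : \int[nu]_x (EFin \o l)^\- x =
    \int[mu]_x (fun x => (q x * l x)%:E)^\- x.
  rewrite (integral_density nufin numu hq)//; last exact: measurable_funeneg.
  apply: eq_integral => x _; rewrite !funenegE /= -!EFin_max -EFinM; congr EFin.
  by rewrite mulrC maxr_pMr// mulr0 mulrN.
have mql : measurable_fun setT (fun x => (q x * l x)%:E)
  by apply/measurable_EFinP; exact: measurable_funM.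
have ql0 : 0 <= \int[mu]_x (q x * l x)%:E.
  apply: (le_trans f0); rewrite [leRHS]integralE -posE -negE -integralE.
  exact: le_ae_integral.
have intql : mu.-integrable setT (fun x => (q x * l x)%:E).
  have pos : \int[mu]_x (fun x => (q x * l x)%:E)^\+ x < +oo.
    apply: le_lt_trans (integral_funepos_lt_pinfty measurableT intm).
    apply: ge0_le_integral => //.
    - exact: measurable_funepos.
    - by apply: measurable_funepos; exact/measurable_EFinP.
    - by move=> x _; rewrite !funeposE ge_max !le_max lee_fin qlm lexx orbT.
  apply/integrableP; split => //.
  rewrite -/(abse \o _) fune_abse ge0_integralD//; last 2 first.
    exact: measurable_funepos.
    exact: measurable_funeneg.
  rewrite lte_add_pinfty// ltey; apply/eqP => neg.
  by move: ql0; rewrite integralE neg; case: integral pos.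
have m0 : \int[mu]_x (m x)%:E = 0.
  apply/eqP; rewrite eq_le m_le0 (le_trans ql0)// le_integral// => x _.
  by rewrite lee_fin.
have : {ae mu, forall x, (m x - q x * l x = 0)%R}.
  apply: ae_eq0_integral => [|x|]; rewrite ?subr_ge0//.
    by apply: measurable_funB => //; exact: measurable_funM.
  apply/eqP; rewrite eq_le integral_ge0 ?andbT; last first.
    by move=> x _; rewrite lee_fin subr_ge0.
  under eq_integral => x _ do rewrite EFinB.
  by rewrite integralB// m0 sub0e leeNl oppe0.
by apply: filterS => x /eqP; rewrite subr_eq0 => /eqP.
Qed.

Lemma measurable_ltr_set (f g : X -> R) : measurable_fun setT f ->
  measurable_fun setT g -> measurable [set x | (f x < g x)%R].
Proof.
move=> mf mg; rewrite -[X in measurable X]setTI.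
exact: (measurable_fun_ltr mf mg measurableT (Y := [set true])).
Qed.

End Density.

(** * Perturbations of an optimal e-value *)

Section LagrangeMultiplier.
Context (d : measure_display) (X : measurableType d) (R : realType).
Context (P : probability X R) (Qa : {measure set X -> \bar R}).
Context (Qa_fin : Qa setT < +oo) (QaP : Qa `<< P).
Context (q : X -> R) (hq : is_RN_version Qa P q).
Context (U : \bar R -> \bar R).
Context (mU : measurable_fun [set z : \bar R | 0 <= z] U).
Context (U_concave : utility_concave U).
Context (U_nondecreasing : utility_nondecreasing U).
Context (U_finite : utility_finite U).
Context (estar : X -> \bar R) (estar_opt : U_optimal U P Qa estar).

(** Real-valued versions of estar, of its utility and of U on positive reals.
    Where the arguments are infinite these take the value 0, which affects only
    null sets, except for the utility on the set where q vanishes: there it is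
    always multiplied by q. *)
Let z (x : X) : R := fine (estar x).
Let u (x : X) : R := fine (U (estar x)).
Let v (w : R) : R := fine (U w%:E).

Definition excess (c w : R) (x : X) : R := q x * (v w - u x) - c * (w - z x).

Let mq : measurable_fun setT q. Proof. by case: hq. Qed.
Let q0 x : (0 <= q x)%R. Proof. by case: hq => _ /(_ x). Qed.
Let e0 x : 0 <= estar x. Proof. by case: estar_opt => -[[]]. Qed.
Let mestar : measurable_fun setT estar.
Proof. by case: estar_opt => -[[]]. Qed.
Let int_estar : \int[P]_x estar x <= 1.
Proof. by case: estar_opt => -[]. Qed.
Let z0 x : (0 <= z x)%R. Proof. exact: fine_ge0. Qed.
Let mz : measurable_fun setT z. Proof. exact: measurableT_comp. Qed.

Let measurable_utility (f : X -> \bar R) : measurable_fun setT f ->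
  (forall x, 0 <= f x) -> measurable_fun setT (U \o f).
Proof.
move=> mf f0; apply: (measurable_comp _ _ mU) => //; last first.
  by move=> _ [x _ <-] /=.
rewrite (_ : [set _ | _] = `[0, +oo]%classic :> set (\bar R)).
  exact: emeasurable_itv.
by apply/seteqP; split => y /=; rewrite in_itv/= ?leey ?andbT.
Qed.

Let measurable_u : measurable_fun setT u.
Proof. by apply: measurableT_comp => //; exact: measurable_utility. Qed.

Let measurable_v (t : X -> R) : measurable_fun setT t ->
  (forall x, (0 < t x)%R) -> measurable_fun setT (fun x => v (t x)).
Proof.
move=> mt t0; apply: (measurableT_comp (fine_measurable measurableT)).
apply: (measurable_utility (f := EFin \o t)); first exact/measurable_EFinP.
by move=> x; rewrite lee_fin ltW.
Qed.

Let estar_fin : {ae P, forall x, estar x = (z x)%:E}.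
Proof.
have : P.-integrable setT estar.
  apply/integrableP; split => //.
  under eq_integral => x _ do rewrite gee0_abs//.
  by rewrite (le_lt_trans int_estar)// ltry.
move/(integrable_ae measurableT); apply: filterS => x /(_ I) xfin.
by rewrite /z fineK.
Qed.

(** Comparing estar with itself: the difference of its utility with itself must
    not be of the form oo - oo. *)
Let Uestar_fin : {ae Qa, forall x, U (estar x) = (u x)%:E}.
Proof.
have [valid /(_ _ valid)[[+ _] _]] := estar_opt.
apply: filterS => x /=; rewrite /u; by case: (U (estar x)).
Qed.

Let int_zE : \int[P]_x (z x)%:E = \int[P]_x estar x.
Proof.
apply: ae_eq_integral => //; first exact/measurable_EFinP.
by apply: filterS estar_fin => x -> _.
Qed.

Let v_fin (w : R) : (0 < w)%R -> U w%:E = (v w)%:E.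
Proof. by move=> w0; rewrite /v fineK//; exact: U_finite. Qed.

Let integrable_mean_le1 (f : X -> R) :
  measurable_fun setT f -> (forall x, (0 <= f x)%R) ->
  \int[P]_x (f x)%:E <= 1 -> P.-integrable setT (EFin \o f).
Proof.
move=> mf f0 f1; apply/integrableP; split; first exact/measurable_EFinP.
under eq_integral => x _ do rewrite /= ger0_norm//.
by rewrite (le_lt_trans f1)// ltry.
Qed.

Let int_z : P.-integrable setT (EFin \o z).
Proof. by apply: integrable_mean_le1 => //; rewrite int_zE. Qed.

(** Concavity bounds the loss U estar - U y of the perturbation
    y = s * t + (1 - s) * z by s * (U estar - U t). If the change of mean has a
    nonnegative value at price c, the gain in utility is at least the integral
    of s times the excess; optimality forbids a gain, so a nonnegative integrand
    vanishes. *)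
Lemma mixing_no_gain (c : R) (s t : X -> R) :
  measurable_fun setT s -> measurable_fun setT t ->
  (forall x, (0 <= s x <= 1)%R) -> (forall x, (0 < t x)%R) ->
  (forall x, (0 <= s x * excess c (t x) x)%R) ->
  \int[P]_x (s x * t x + (1 - s x) * z x)%:E <= 1 ->
  \int[P]_x (c * (s x * (z x - t x)))%:E <= 0 ->
  {ae P, forall x, (s x * excess c (t x) x = 0)%R}.
Proof.
move=> ms mt s01 t0 gain0 int1 cint0.
pose y x := (s x * t x + (1 - s x) * z x)%R.
have s0 x : (0 <= s x)%R by case/andP: (s01 x).
have s1 x : (0 <= 1 - s x)%R by case/andP: (s01 x); rewrite subr_ge0.
have y0 x : (0 <= y x)%R.
  by rewrite /y addr_ge0// mulr_ge0// ltW.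
have my : measurable_fun setT y.
  apply: measurable_funD; apply: measurable_funM => //.
  exact: measurable_funB.
have mUy : measurable_fun setT (fun x => U (y x)%:E).
  apply: (measurable_utility (f := EFin \o y)); first exact/measurable_EFinP.
  by move=> x; rewrite lee_fin.
have yvalid : valid_e_value P (EFin \o y).
  split => //; split; first exact/measurable_EFinP.
  by move=> x; rewrite lee_fin.
have [_ /(_ _ yvalid)[_ opt]] := estar_opt.
pose l x := (s x * (u x - v (t x)))%R.
pose m x := (c * (s x * (z x - t x)))%R.
have ml : measurable_fun setT l.
  apply: measurable_funM => //.
  by apply: measurable_funB => //; exact: measurable_v.
have intm : P.-integrable setT (EFin \o m).
  have -> : EFin \o m = (fun x => c%:E * ((EFin \o z) \- (EFin \o y)) x).
    by apply/funext => x; rewrite /= -EFinB -EFinM /m /y; congr EFin; ring.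
  apply: integrableZl => //; apply: integrableB => //.
  exact: integrable_mean_le1.
have qlm x : (q x * l x <= m x)%R.
  have := gain0 x; rewrite /excess /l /m; lra.
have fl : {ae Qa, forall x, U (estar x) - U (y x)%:E <= (l x)%:E}.
  apply: filterS2 Uestar_fin (ae_dominated QaP estar_fin) => x Ux ex.
  have : (u x - l x)%:E <= U (y x)%:E.
    have := U_concave (ltW (t0 x)) (z0 x) (s01 x).
    rewrite v_fin// -ex Ux -!EFinM -EFinD; apply: le_trans.
    by rewrite lee_fin /l; lra.
  rewrite Ux; case: (U (y x)%:E) => [r| |]//=; rewrite ?leNye//.
  by rewrite -EFinB !lee_fin; lra.
have : {ae P, forall x, (q x * l x = m x)%R}.
  apply: ae_eq_density_majorant Qa_fin QaP hq _ ml opt fl intm qlm cint0.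
  by apply: emeasurable_funB => //; exact: measurable_utility.
by apply: filterS => x; rewrite /l /m /excess => h; lra.
Qed.
(** The default value 0 of z at infinite points makes this valid everywhere, not
    just almost everywhere. *)
Let z_gt0 x : (0 < z x)%R -> estar x = (z x)%:E /\ U (estar x) = (u x)%:E.
Proof.
move=> zx; have ex : estar x = (z x)%:E.
  by move: zx; rewrite /z; case: (estar x) => //=; rewrite ltxx.
by split => //; rewrite /u ex [RHS]fineK//; exact: U_finite.
Qed.

Let measurable_excess c w : measurable_fun setT (excess c w).
Proof.
apply: measurable_funB; apply: measurable_funM => //; exact: measurable_funB.
Qed.

Let raise_set c w := [set x | (z x < w)%R /\ (0 < excess c w x)%R].
Let lower_set c w := [set x | (w < z x)%R /\ (0 < excess c w x)%R].

Let measurable_raise_set c w : measurable (raise_set c w).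
Proof.
rewrite (_ : raise_set c w =
  [set x | z x < w]%R `&` [set x | 0 < excess c w x]%R)//.
by apply: measurableI; exact: measurable_ltr_set.
Qed.

Let measurable_lower_set c w : measurable (lower_set c w).
Proof.
rewrite (_ : lower_set c w =
  [set x | w < z x]%R `&` [set x | 0 < excess c w x]%R)//.
by apply: measurableI; exact: measurable_ltr_set.
Qed.

(** The excess is concave in the target and vanishes at z, so it cannot be
    positive on both sides of z. Hence the sets on which one raises and on which
    one lowers the e-value are disjoint. *)
Lemma excess_sides (c w w' : R) x : (0 < w')%R -> (w' < z x)%R ->
  (z x < w)%R -> (0 < excess c w x)%R -> (excess c w' x <= 0)%R.
Proof.
move=> w'0 w'z zw gain; rewrite leNgt; apply/negP => gain'.
have ww' : (0 < w - w')%R by lra.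
pose th := ((z x - w') / (w - w'))%R.
have thE : (th * (w - w') = z x - w')%R by rewrite /th divfK// gt_eqF.
have th0 : (0 < th)%R by rewrite divr_gt0//; lra.
have th1 : (th < 1)%R by rewrite ltr_pdivrMr//; lra.
have zE : (th * w + (1 - th) * w' = z x)%R by lra.
have w0 : (0 < w)%R by lra.
have [ex Ux] : estar x = (z x)%:E /\ U (estar x) = (u x)%:E.
  by apply: z_gt0; lra.
have th01 : (0 <= th <= 1)%R by rewrite !ltW.
have := U_concave (ltW w0) (ltW w'0) th01.
rewrite zE -ex Ux !v_fin// -!EFinM -EFinD lee_fin => conc.
have : (0 < th * excess c w x + (1 - th) * excess c w' x)%R.
  by rewrite addr_gt0// mulr_gt0// subr_gt0.
have -> : (th * excess c w x + (1 - th) * excess c w' x =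
   q x * (th * v w + (1 - th) * v w' - u x) -
   c * (th * w + (1 - th) * w' - z x))%R by rewrite /excess; ring.
by rewrite zE subrr mulr0 subr0 ltNge mulr_ge0_le0// subr_le0.
Qed.

Let deficit c w (x : X) : R := (w - z x) * \1_(raise_set c w) x.
Let surplus c w (x : X) : R := (z x - w) * \1_(lower_set c w) x.

Let deficit_ge0 c w x : (0 <= deficit c w x)%R.
Proof.
rewrite /deficit indicE; case: (boolP (x \in _)) => [|_]; last by rewrite mulr0.
by rewrite inE mulr1 => -[? _]; rewrite subr_ge0 ltW.
Qed.

Let surplus_ge0 c w x : (0 <= surplus c w x)%R.
Proof.
rewrite /surplus indicE; case: (boolP (x \in _)) => [|_]; last by rewrite mulr0.
by rewrite inE mulr1 => -[? _]; rewrite subr_ge0 ltW.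
Qed.

Let measurable_deficit c w : measurable_fun setT (deficit c w).
Proof.
apply: measurable_funM; first exact: measurable_funB.
by apply: measurable_indic; exact: measurable_raise_set.
Qed.

Let measurable_surplus c w : measurable_fun setT (surplus c w).
Proof.
apply: measurable_funM; first exact: measurable_funB.
by apply: measurable_indic; exact: measurable_lower_set.
Qed.

Let int_shift w : P.-integrable setT (EFin \o (fun x => w - z x)%R).
Proof.
have -> : EFin \o (fun x => w - z x)%R = (fun x => (cst w%:E \- (EFin \o z)) x).
  by apply/funext => x /=; rewrite EFinB.
by apply: integrableB => //; exact: finite_measure_integrable_cst.
Qed.

Let int_deficit c w : P.-integrable setT (EFin \o deficit c w).
Proof.
apply: le_integrable (int_shift w) => //; first exact/measurable_EFinP.
move=> x _ /=; rewrite lee_fin /deficit normrM ler_piMr//.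
by rewrite indicE; case: (_ \in _); rewrite ?normr0 ?normr1.
Qed.

Let int_surplus c w : P.-integrable setT (EFin \o surplus c w).
Proof.
apply: le_integrable (int_shift w) => //; first exact/measurable_EFinP.
move=> x _ /=; rewrite lee_fin /surplus distrC normrM ler_piMr//.
by rewrite indicE; case: (_ \in _); rewrite ?normr0 ?normr1.
Qed.

Let mean_deficit c w := fine (\int[P]_x (deficit c w x)%:E).
Let mean_surplus c w := fine (\int[P]_x (surplus c w x)%:E).
Let int_deficitE c w : \int[P]_x (deficit c w x)%:E = (mean_deficit c w)%:E.
Proof.
by rewrite /mean_deficit fineK//; exact: integrable_fin_num (int_deficit _ _).
Qed.

Let int_surplusE c w : \int[P]_x (surplus c w x)%:E = (mean_surplus c w)%:E.
Proof.
by rewrite /mean_surplus fineK//; exact: integrable_fin_num (int_surplus _ _).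
Qed.

Let mean_deficit_ge0 c w : (0 <= mean_deficit c w)%R.
Proof. by rewrite fine_ge0// integral_ge0// => x _; rewrite lee_fin. Qed.
Let mean_surplus_ge0 c w : (0 <= mean_surplus c w)%R.
Proof. by rewrite fine_ge0// integral_ge0// => x _; rewrite lee_fin. Qed.

(** The perturbation moves estar by the fraction a towards w on the first set
    and by the fraction b towards w' on the second; its mean changes by
    a * mean_deficit - b * mean_surplus. *)
Lemma transfer_no_gain (c w w' a b : R) : (0 < w)%R -> (0 < w')%R ->
  (0 <= a <= 1)%R -> (0 <= b <= 1)%R ->
  \int[P]_x estar x + (a * mean_deficit c w - b * mean_surplus c w')%:E <= 1 ->
  (c * (b * mean_surplus c w' - a * mean_deficit c w) <= 0)%R ->
  {ae P, forall x, ((0 < a)%R -> ~ raise_set c w x) /\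
    ((0 < b)%R -> ~ lower_set c w' x)}.
Proof.
move=> w0 w'0 a01 b01 int1 cint.
pose A := raise_set c w; pose B := lower_set c w'.
have mA : measurable A by exact: measurable_raise_set.
have mB : measurable B by exact: measurable_lower_set.
pose s x := (a * \1_A x + b * \1_B x)%R.
(* The target is irrelevant off both sets, where s vanishes. *)
pose t x := (w' + (w - w') * \1_A x)%R.
have AB x : A x -> ~ B x.
  move=> [zw gain] [w'z gain'].
  by have := excess_sides w'0 w'z zw gain; rewrite leNgt gain'.
have cases x : [\/ [/\ A x, ~ B x, s x = a & t x = w],
                   [/\ B x, ~ A x, s x = b & t x = w'] |
                   [/\ ~ A x, ~ B x, s x = 0%R & t x = w']].
  rewrite /s /t !indicE.
  have [xA|xA] := pselect (A x); have [xB|xB] := pselect (B x).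
  - by have := AB _ xA xB.
  - by apply: Or31; split => //=; rewrite (mem_set xA) ?(memNset xB)/=; ring.
  - by apply: Or32; split => //=; rewrite (memNset xA) ?(mem_set xB)/=; ring.
  - by apply: Or33; split => //=; rewrite (memNset xA) ?(memNset xB)/=; ring.
have stE x : (s x * (z x - t x) =
    - a * deficit c w x + b * surplus c w' x)%R.
  rewrite /deficit /surplus -/A -/B.
  have : (\1_A x * \1_B x = 0 :> R)%R.
    have [xA|xA] := pselect (A x); last by rewrite indicE memNset// mul0r.
    by rewrite [X in (_ * X)%R]indicE memNset ?mulr0//; exact: AB.
  have : (\1_A x * \1_A x = \1_A x :> R)%R.
    by rewrite indicE; case: (_ \in _); rewrite ?mulr1 ?mulr0.
  rewrite /s /t; move: (\1_A x) (\1_B x) => i j ii ij.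
  have -> : ((a * i + b * j) * (z x - (w' + (w - w') * i)) =
    a * (z x - w') * i + b * (z x - w') * j -
    a * (w - w') * (i * i) - b * (w - w') * (i * j))%R by ring.
  by rewrite ii ij; ring.
have : {ae P, forall x, (s x * excess c (t x) x = 0)%R}.
  apply: mixing_no_gain.
  - by apply: measurable_funD; apply: measurable_funM => //;
      exact: measurable_indic.
  - by apply: measurable_funD => //; apply: measurable_funM => //;
      exact: measurable_indic.
  - by move=> x; case: (cases x) => -[_ _ -> _] //; rewrite lexx ler01.
  - by move=> x; case: (cases x) => -[_ _ _ ->].
  - move=> x.
    case: (cases x) => [[[_ gain] _ -> ->]|[[_ gain] _ -> ->]|[_ _ -> _]].
    + by apply: mulr_ge0; [case/andP: a01|exact: ltW].
    + by apply: mulr_ge0; [case/andP: b01|exact: ltW].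
    + by rewrite mul0r.
  - apply: le_trans int1.
    rewrite (eq_integral (fun x => (1 * z x +
        1 * (a * deficit c w x + - b * surplus c w' x))%:E)); last first.
      by move=> x _; congr EFin; have := stE x; lra.
    rewrite integral_linear_combination//; last first.
      have -> : EFin \o (fun x => a * deficit c w x + - b * surplus c w' x)%R =
          (fun x => a%:E * (EFin \o deficit c w) x) \+
          (fun x => (- b)%:E * (EFin \o surplus c w') x).
        by apply/funext => x /=; rewrite EFinD !EFinM.
      by apply: integrableD => //; exact: integrableZl.
    rewrite integral_linear_combination// !mul1e int_zE.
    rewrite int_deficitE int_surplusE.
    by rewrite -!EFinM -EFinD mulNr.
  - rewrite (eq_integral (fun x =>
        (- (c * a) * deficit c w x + (c * b) * surplus c w' x)%:E)); last first.
      by move=> x _; congr EFin; rewrite stE; ring.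
    rewrite integral_linear_combination// int_deficitE int_surplusE.
    rewrite -!EFinM -EFinD lee_fin.
    by apply: le_trans cint; lra.
apply: filterS => x sx; split => ab0 xAB.
  case: (cases x) => -[] // [_ gain] _ sE tE.
  by move/eqP: sx; rewrite sE tE mulf_eq0 !gt_eqF.
case: (cases x) => -[] // [_ gain] _ sE tE.
by move/eqP: sx; rewrite sE tE mulf_eq0 !gt_eqF.
Qed.

(** * The multiplier *)

(** A small raise keeps the e-value valid when its mean is below 1, so that
    raising it cannot increase the utility even when it is free. *)
Lemma slack_multiplier (w : R) : \int[P]_x estar x < 1 -> (0 < w)%R ->
  {ae P, forall x, (z x < w)%R -> (excess 0 w x <= 0)%R}.
Proof.
move=> slack w0.
pose E := fine (\int[P]_x estar x).
have EE : \int[P]_x estar x = E%:E.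
  rewrite /E fineK// ge0_fin_numE ?integral_ge0//.
  by rewrite (lt_trans slack)// ltry.
have E0 : (0 <= E)%R by rewrite -lee_fin -EE integral_ge0.
have E1 : (E < 1)%R by rewrite -lte_fin -EE.
have m0 := mean_deficit_ge0 0 w.
(* Any a in (0, 1] with a * mean_deficit 0 w <= 1 - E would do. *)
pose a := ((1 - E) / (1 + mean_deficit 0 w))%R.
have aE : (a * (1 + mean_deficit 0 w) = 1 - E)%R.
  by rewrite /a divfK// gt_eqF//; lra.
have a0 : (0 < a)%R by rewrite divr_gt0//; lra.
have a1 : (a <= 1)%R by rewrite ler_pdivrMr; lra.
have : {ae P, forall x, ((0 < a)%R -> ~ raise_set 0 w x) /\
    ((0 < 0 :> R)%R -> ~ lower_set 0 w x)}.
  apply: transfer_no_gain => //.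
  - by rewrite (ltW a0) a1.
  - by rewrite lexx ler01.
  - by rewrite EE -EFinD lee_fin mul0r subr0; lra.
  - by rewrite mul0r.
apply: filterS => x [/(_ a0) nA _] zw.
by rewrite leNgt; apply/negP => gain; exact: nA.
Qed.

(** One of the two sets has to be null, since otherwise payoff could be moved
    from the second to the first with a net gain, whatever its price c. *)
Lemma two_sided_exchange (c w w' : R) : (0 < w)%R -> (0 < w')%R ->
  {ae P, forall x, (z x < w)%R -> (excess c w x <= 0)%R} \/
  {ae P, forall x, (w' < z x)%R -> (excess c w' x <= 0)%R}.
Proof.
move=> w0 w'0.
have [mA0|mA0] := eqVneq (mean_deficit c w) 0%R.
  left; have : {ae P, forall x, (deficit c w x = 0)%R}.
    by apply: ae_eq0_integral => //; rewrite int_deficitE mA0.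
  apply: filterS => x + zw; rewrite leNgt => /eqP df; apply/negP => gain.
  by move: df; rewrite /deficit indicE mem_set// mulr1 gt_eqF// subr_gt0.
have [mB0|mB0] := eqVneq (mean_surplus c w') 0%R.
  right; have : {ae P, forall x, (surplus c w' x = 0)%R}.
    by apply: ae_eq0_integral => //; rewrite int_surplusE mB0.
  apply: filterS => x + zw; rewrite leNgt => /eqP df; apply/negP => gain.
  by move: df; rewrite /surplus indicE mem_set// mulr1 gt_eqF// subr_gt0.
have mA : (0 < mean_deficit c w)%R by rewrite lt_def mA0/=.
have mB : (0 < mean_surplus c w')%R by rewrite lt_def mB0/=.
pose D := (mean_deficit c w + mean_surplus c w')%R.
have D0 : (0 < D)%R by rewrite addr_gt0.
(* The weights are chosen so that what is added on one set is exactly what is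
   taken away on the other: the mean of the e-value does not move. *)
pose a := (mean_surplus c w' / D)%R; pose b := (mean_deficit c w / D)%R.
have a0 : (0 < a)%R by rewrite divr_gt0.
have balance : (a * mean_deficit c w = b * mean_surplus c w')%R.
  by rewrite /a /b; ring.
left; have : {ae P, forall x, ((0 < a)%R -> ~ raise_set c w x) /\
    ((0 < b)%R -> ~ lower_set c w' x)}.
  apply: transfer_no_gain => //.
  - by rewrite (ltW a0) ler_pdivrMr// mul1r /D lerDr ltW.
  - by rewrite divr_ge0 ?(ltW D0)// ler_pdivrMr// mul1r /D lerDl ltW.
  - by rewrite balance subrr adde0.
  - by rewrite balance subrr mulr0.
apply: filterS => x [/(_ a0) nA _] zw.
by rewrite leNgt; apply/negP => gain; exact: nA.
Qed.

Definition no_gain_above (c : R) := forall r : rat, (0 < r)%R ->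
  {ae P, forall x, (z x < ratr r)%R -> (excess c (ratr r) x <= 0)%R}.

(** If raising paid at every price, lowering would pay at none, in particular at
    no large one; but where z > 0 lowering the e-value does pay when payoff is
    expensive enough. So estar would vanish, the constraint would be slack, and
    raising would not pay at price 0. *)
Lemma multiplier_set_nonempty : exists2 c : R, (0 <= c)%R & no_gain_above c.
Proof.
apply: contrapT => none.
have below (r : rat) (k : nat) : (0 < r)%R ->
    {ae P, forall x, (ratr r < z x)%R -> (excess k%:R (ratr r) x <= 0)%R}.
  move=> r0; apply: contrapT => nB; apply: none; exists k%:R => // r' r'0.
  have rr0 : (0 < ratr r :> R)%R by rewrite ltr0q.
  have rr'0 : (0 < ratr r' :> R)%R by rewrite ltr0q.
  by have [] := two_sided_exchange k%:R rr'0 rr0.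
have z_le (r : rat) : (0 < r)%R -> {ae P, forall x, (z x <= ratr r)%R}.
  move=> r0; have := ae_forall_countable (below r ^~ r0).
  apply: filterS => x bd; rewrite leNgt; apply/negP => rz.
  pose g := (q x * (v (ratr r) - u x))%R.
  have d0 : (0 < z x - ratr r)%R by rewrite subr_gt0.
  pose k := Num.bound `|- g / (z x - ratr r)|%R.
  have := bd k rz; rewrite /excess -/g.
  have : (- g / (z x - ratr r) < k%:R)%R.
    exact: le_lt_trans (ler_norm _) (archi_boundP (normr_ge0 _)).
  by rewrite ltr_pdivrMr//; move: (k%:R)%R => K; lra.
have z_eq0 : {ae P, forall x, z x = 0%R}.
  have : {ae P, forall x (r : rat), (0 < r)%R -> (z x <= ratr r)%R}.
    apply: ae_forall_countable => r.
    by have [/z_le|] := boolP (0 < r)%R; [apply: filterS|move=> _; exact: aeW].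
  apply: filterS => x zr; apply/eqP; rewrite eq_le z0 andbT leNgt.
  apply/negP => /rat_in_itvoo[r]; rewrite in_itv/= ltr0q => /andP[r0 rz].
  by have := zr r r0; rewrite leNgt rz.
apply: none; exists 0%R => // r r0.
apply: slack_multiplier; last by rewrite ltr0q.
rewrite -int_zE (_ : \int[P]_x _ = 0) ?lte01//.
rewrite (ae_eq_integral (cst 0)) ?integral0//; first exact/measurable_EFinP.
by apply: filterS z_eq0 => x ->.
Qed.

(** Prices above the infimum rule out a gain from raising. At prices below it
    raising pays on a non-null set, so that by exchange lowering does not pay;
    at negative prices it does not pay because U is nondecreasing. Both
    conclusions pass to the limit at the infimum. *)
Lemma multiplier_exists : exists lambda : R,
  [/\ (0 <= lambda)%R,
      \int[P]_x estar x < 1 -> lambda = 0%R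
    & {ae P, forall x (r : rat), (0 < r)%R ->
        (excess lambda (ratr r) x <= 0)%R}].
Proof.
have [c0 c00 c0S] := multiplier_set_nonempty.
pose S := [set c : R | (0 <= c)%R /\ no_gain_above c].
have infS : has_inf S.
  by split; [exists c0|exists 0%R => c [] //].
pose lambda := inf S.
have lambda0 : (0 <= lambda)%R by apply: lb_le_inf; [exact: infS.1|move=> c []].
exists lambda; split => //.
  move=> slack; apply/eqP; rewrite eq_le lambda0 andbT.
  apply: ge_inf; first exact: infS.2.
  split=> // r r0; apply: slack_multiplier => //; by rewrite ltr0q.
have above (r : rat) (k : nat) : (0 < r)%R -> {ae P, forall x,
    (z x < ratr r)%R -> (excess (lambda + k.+1%:R^-1) (ratr r) x <= 0)%R}.
  move=> r0; have k0 : (0 < k.+1%:R^-1 :> R)%R by [].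
  have [c [c1 /(_ r r0) cS] clt] := inf_adherent k0 infS.
  apply: filterS cS => x cS zr; apply: le_trans (cS zr); rewrite /excess.
  by rewrite lerD2l lerN2 ler_wpM2r ?subr_ge0 ?ltW//.
have below (r : rat) (k : nat) : (0 < r)%R -> {ae P, forall x,
    (ratr r < z x)%R -> (excess (lambda - k.+1%:R^-1) (ratr r) x <= 0)%R}.
  move=> r0; have k0 : (0 < k.+1%:R^-1 :> R)%R by [].
  have [c1|c1] := leP 0%R (lambda - k.+1%:R^-1)%R; last first.
    apply: aeW => x rz; have rr0 : (0 < ratr r :> R)%R by rewrite ltr0q.
    have [ex Ux] := z_gt0 (lt_trans rr0 rz).
    have : (v (ratr r) <= u x)%R.
      by rewrite -lee_fin -Ux -v_fin// ex U_nondecreasing// ltW.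
    by rewrite /excess; have := q0 x; move: c1 rz; set e := (_^-1)%R; nra.
  have : ~ no_gain_above (lambda - k.+1%:R^-1).
    move=> dom; have : (lambda <= lambda - k.+1%:R^-1)%R.
      by apply: ge_inf => //; exact: infS.2.
    by rewrite leNgt ltrBlDr ltrDl k0.
  move=> ndom; apply: contrapT => nB; apply: ndom => r' r'0.
  have rr0 : (0 < ratr r :> R)%R by rewrite ltr0q.
  have rr'0 : (0 < ratr r' :> R)%R by rewrite ltr0q.
  by have [] := two_sided_exchange (lambda - k.+1%:R^-1) rr'0 rr0.
have : {ae P, forall x (rk : rat * nat), (0 < rk.1)%R ->
    ((z x < ratr rk.1)%R ->
      (excess (lambda + rk.2.+1%:R^-1) (ratr rk.1) x <= 0)%R) /\
    ((ratr rk.1 < z x)%R ->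
      (excess (lambda - rk.2.+1%:R^-1) (ratr rk.1) x <= 0)%R)}.
  apply: ae_forall_countable => -[r k] /=.
  have [r0|_] := boolP (0 < r)%R; last exact: aeW.
  by apply: filterS2 (above r k r0) (below r k r0).
apply: filterS => x bd r r0.
have rr0 : (0 < ratr r :> R)%R by rewrite ltr0q.
have [rz|zr|zr] := ltgtP (ratr r) (z x).
- rewrite leNgt; apply/negP => gain; have d0 : (0 < z x - ratr r)%R by lra.
  have [k] := ltr_add_invr (divr_gt0 gain d0); rewrite add0r ltr_pdivlMr//.
  have := (bd (r, k) r0).2 rz; rewrite /excess/=.
  by move: (_^-1)%R => e; lra.
- rewrite leNgt; apply/negP => gain; have d0 : (0 < ratr r - z x)%R by lra.
  have [k] := ltr_add_invr (divr_gt0 gain d0); rewrite add0r ltr_pdivlMr//.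
  have := (bd (r, k) r0).1 zr; rewrite /excess/=.
  by move: (_^-1)%R => e; lra.
- have [ex Ux] : estar x = (z x)%:E /\ U (estar x) = (u x)%:E.
    by apply: z_gt0; rewrite -zr.
  have -> : excess lambda (ratr r) x = 0%R.
    have -> : excess lambda (ratr r) x = (q x * (v (z x) - u x))%R.
      by rewrite /excess zr subrr mulr0 subr0.
    by rewrite /u ex subrr mulr0.
  by [].
Qed.

(** Bounding U w by U r for rationals r > w that decrease to w avoids continuity
    of U and covers w = 0, where U may be -oo. *)
Lemma excess_argmax (lambda : R) : (0 <= lambda)%R ->
  {ae P, forall x (r : rat), (0 < r)%R -> (excess lambda (ratr r) x <= 0)%R} ->
  {ae P, forall x, argmax [set y : \bar R | 0 <= y < +oo]
    (fun y => (q x)%:E * U y - lambda%:E * y) (estar x)}.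
Proof.
move=> lambda0.
apply: filterS3 estar_fin (ae_density hq Uestar_fin) => x ex Ux noexcess.
have qUE : (q x)%:E * U (estar x) = (q x * u x)%:E.
  have := q0 x; rewrite le_eqVlt => /predU1P[<-|/Ux ->//].
  by rewrite mul0e mul0r.
split; first by rewrite /= ex lee_fin z0 ltry.
move=> y /=; case: y => [w| |]; rewrite ?ltxx ?andbF// => /andP[w0 _].
rewrite lee_fin in w0.
rewrite qUE {1}ex -!EFinM leeBlDr// -EFinB -EFinD.
apply/lee_addgt0Pr => e e_gt0.
(* A step of at most e / (1 + lambda) in the target costs less than e at price
   lambda. *)
have : (w < w + e / (1 + lambda))%R by rewrite ltrDl divr_gt0//; lra.
move=> /rat_in_itvoo[r]; rewrite in_itv/= => /andP[wr re].
have rr0 : (0 < ratr r :> R)%R by exact: le_lt_trans wr.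
have r0 : (0 < r)%R by rewrite ltr0q in rr0.
apply: (@le_trans _ _ ((q x)%:E * U (ratr r)%:E)).
  by rewrite lee_wpmul2l ?lee_fin// U_nondecreasing// ltW.
rewrite v_fin// -EFinM -EFinD lee_fin.
have re' : ((ratr r - w) * (1 + lambda) < e)%R.
  by rewrite -ltr_pdivlMr ?ltrBlDl//; lra.
have := noexcess r r0; rewrite /excess; nra.
Qed.

End LagrangeMultiplier.

Theorem proposition2 (d : measure_display) (X : measurableType d) (R : realType)
    (P Q : probability X R) (Qa Qs : {measure set X -> \bar R})
    (hQ : lebesgue_decomposition Q P Qa Qs)
    (q : X -> R) (hq : is_RN_version Qa P q)
    (U : \bar R -> \bar R)
    (mU : measurable_fun [set z : \bar R | 0 <= z] U)
    (U_concave : utility_concave U)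
    (U_nondecreasing : utility_nondecreasing U)
    (U_finite : utility_finite U)
    (estar : X -> \bar R)
    (estar_opt : U_optimal U P Qa estar) :
  exists lambda : R,
    [/\ (0 <= lambda)%R,
        {ae P, forall x, argmax [set z : \bar R | 0 <= z < +oo]
                           (fun z => (q x)%:E * U z - lambda%:E * z) (estar x)}
      & lambda%:E * (1 - \int[P]_x estar x) = 0].
Proof.
have [QE QaP _] := hQ.
have Qa_fin : Qa setT < +oo.
  apply: (@le_lt_trans _ _ (Q setT)); last by rewrite probability_setT ltry.
  by rewrite QE// leeDl.
have [lambda [lambda0 slack noexcess]] := multiplier_exists Qa_fin QaP hq mU
  U_concave U_nondecreasing U_finite estar_opt.
exists lambda; split => //.
  exact: (excess_argmax hq U_nondecreasing U_finite estar_opt).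
have [[[_ _] le1] _] := estar_opt.
move: le1; rewrite le_eqVlt => /predU1P[->|/slack ->]; last by rewrite mul0e.
by rewrite subee// mule0.
Qed.
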